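(* Let $s\ge 1$ be an integer, $q_0=2^s$, $q=2q_0^2$, let $\mathbb K$ be an algebraically closed field of characteristic $2$, and let $\mathbb K(\mathcal S_q)=\mathbb K(x,y)$, with $y^q+y=x^{q_0}(x^q+x)$, be the Suzuki function field, with full automorphism group $\operatorname{Sz}(q)$. Put $$\theta=(x^q+x)^{q-1},\qquad B_S(T)=1+T^q+T^{q+2q_0}+T^{q+2q_0+1},\qquad t_S=\frac{B_S(\theta)^{q-2q_0+1}}{\theta^{q^2}}.$$ Then the fixed field of $\operatorname{Sz}(q)$ is $$\mathbb K(\mathcal S_q)^{\operatorname{Sz}(q)}=\mathbb K(t_S).$$
   Context: The Suzuki curve $\mathcal S_q$ is the nonsingular model of the affine curve $y^q+y=x^{q_0}(x^q+x)$ over $\mathbb K$; its function field is $\mathbb K(\mathcal S_q)=\mathbb K(x,y)$. Its full group of $\mathbb K$-automorphisms is (isomorphic to) the Suzuki group $\operatorname{Sz}(q)$, of order $q^2(q-1)(q^2+1)$. Explicitly, put $z=x^{2q_0+1}+y^{2q_0}$ and $w=xy^{2q_0}+z^{2q_0}$; one has $y=x^{q_0+1}+z^{q_0}$, so an automorphism is determined by the images of $x$ and $z$. The group is generated by the following $\mathbb K$-automorphisms: for $a,c\in\mathbb F_q$, $\tau_{a,c}: x\mapsto x+a,\ z\mapsto z+a^{2q_0}x+c,\ w\mapsto w+az+(a^{2q_0+1}+c)x+a^{2q_0+2}+ac+c^{2q_0}$; for $d\in\mathbb F_q^*$, $\psi_d: x\mapsto dx,\ z\mapsto d^{2q_0+1}z,\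 w\mapsto d^{2q_0+2}w$; and the involution $\iota: x\mapsto z/w,\ z\mapsto x/w,\ w\mapsto 1/w$. For a group $G$ of automorphisms of a field $F$, $F^G$ denotes the fixed field. *)

(* Defs.v *)
From HB Require Import structures.
From mathcomp Require Import all_boot all_order all_algebra.

Set Implicit Arguments.
Unset Strict Implicit.
Unset Printing Implicit Defensive.

Import GRing.Theory.
Local Open Scope ring_scope.

(* An extension F of K is given by a (necessarily injective) ring morphism
   iota : K -> F, since F need not be of finite degree over K. *)

(* The subfield K(S) of F; since 0^-1 = 0, inverting needs no side condition. *)
Inductive generated_subfield (K F : fieldType) (iota : {rmorphism K -> F})
    (S : F -> Prop) : F -> Prop :=
| gen_const (c : K) : generated_subfield iota S (iota c)
| gen_elem (u : F) : S u -> generated_subfield iota S u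
| gen_sub (u v : F) : generated_subfield iota S u ->
    generated_subfield iota S v -> generated_subfield iota S (u - v)
| gen_mul (u v : F) : generated_subfield iota S u ->
    generated_subfield iota S v -> generated_subfield iota S (u * v)
| gen_inv (u : F) : generated_subfield iota S u ->
    generated_subfield iota S u^-1.

Definition K_automorphism (K F : fieldType) (iota : {rmorphism K -> F})
    (f : {rmorphism F -> F}) : Prop :=
  bijective f /\ forall c : K, f (iota c) = iota c.

(* The group of field automorphisms generated by a family S of automorphisms;
   automorphisms are compared extensionally. *)
Inductive generated_group (F : fieldType) (S : {rmorphism F -> F} -> Prop) :
    {rmorphism F -> F} -> Prop :=
| grp_gen (f : {rmorphism F -> F}) : S f -> generated_group S f
| grp_one (f : {rmorphism F -> F}) : f =1 id -> generated_group S f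
| grp_comp (f g h : {rmorphism F -> F}) : generated_group S f ->
    generated_group S g -> h =1 f \o g -> generated_group S h
| grp_inv (f g : {rmorphism F -> F}) : generated_group S f ->
    cancel f g -> cancel g f -> generated_group S g.

Definition fixed_field (F : fieldType) (G : {rmorphism F -> F} -> Prop)
    (u : F) : Prop :=
  forall f : {rmorphism F -> F}, G f -> f u = u.

(* F = K(x, y) is the function field of the (irreducible) affine curve
   y^q + y = x^q0 (x^q + x): transcendence of x over K says that (x, y) is a
   generic point of the curve, and determines (F, x, y) up to K-isomorphism. *)
Record suzuki_function_field (K F : fieldType) (iota : {rmorphism K -> F})
    (q0 q : nat) (x y : F) : Prop := SuzukiFunctionField {
  suzuki_transcendental : ~ algebraicOver iota x;
  suzuki_equation : y ^+ q + y = x ^+ q0 * (x ^+ q + x);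
  suzuki_generated :
    forall u : F, generated_subfield iota (fun v => v = x \/ v = y) u
}.

Section SuzukiGroup.
Variables (K F : fieldType) (iota : {rmorphism K -> F}) (q0 q : nat) (x y : F).

Definition suzuki_z : F := x ^+ (2 * q0 + 1) + y ^+ (2 * q0).
Definition suzuki_w : F := x * y ^+ (2 * q0) + suzuki_z ^+ (2 * q0).

Local Notation z := suzuki_z.
Local Notation w := suzuki_w.

(* The subfield F_q of K is the set of roots of T^q - T. *)
Definition suzuki_tau (a c : K) (f : {rmorphism F -> F}) : Prop :=
  [/\ K_automorphism iota f,
      f x = x + iota a,
      f z = z + iota (a ^+ (2 * q0)) * x + iota c
    & f w = w + iota a * z + iota (a ^+ (2 * q0 + 1) + c) * x
            + iota (a ^+ (2 * q0 + 2) + a * c + c ^+ (2 * q0))].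

Definition suzuki_psi (d : K) (f : {rmorphism F -> F}) : Prop :=
  [/\ K_automorphism iota f,
      f x = iota d * x,
      f z = iota (d ^+ (2 * q0 + 1)) * z
    & f w = iota (d ^+ (2 * q0 + 2)) * w].

Definition suzuki_iota (f : {rmorphism F -> F}) : Prop :=
  [/\ K_automorphism iota f, f x = z / w, f z = x / w & f w = w^-1].

Definition suzuki_generator (f : {rmorphism F -> F}) : Prop :=
  [\/ exists a c : K, [/\ a ^+ q = a, c ^+ q = c & suzuki_tau a c f],
      exists d : K, [/\ d ^+ q = d, d != 0 & suzuki_psi d f]
    | suzuki_iota f].

(* Sz(q) as a concrete group of K-automorphisms of K(x, y), given by its
   explicit generators; a classical theorem says that it is the full group
   of K-automorphisms. *)
Definition Sz : {rmorphism F -> F} -> Prop := generated_group suzuki_generator.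

Definition suzuki_theta : F := (x ^+ q + x) ^+ (q - 1).

Definition suzuki_B (T : F) : F :=
  1 + T ^+ q + T ^+ (q + 2 * q0) + T ^+ (q + 2 * q0 + 1).

(* As q = 2 q0^2 >= 2 q0, the truncated subtraction below is exact. *)
Definition suzuki_t : F :=
  suzuki_B suzuki_theta ^+ (q - 2 * q0 + 1) / suzuki_theta ^+ (q ^ 2).

End SuzukiGroup.

(* Main.v *)
Require Import Defs.
From HB Require Import structures.
From mathcomp Require Import all_boot all_order all_algebra.
From mathcomp Require Import separable ring zify.

Set Implicit Arguments.
Unset Strict Implicit.
Unset Printing Implicit Defensive.

Import GRing.Theory.
Local Open Scope ring_scope.
Local Open Scope quotient_scope.

(* Put r = 2 q0, d = x^q + x and m = q - r + 1. Then K(S_q) = K(x, z) with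
   z^q + z = x^r d and w = x z + x^(r+2) + z^r.

   Fixed field contained in K(t): descend K(x, z) > K(x) > K(d) > K(theta) > K(t).
   At each step K'(v) > K' the generator v is a root of an explicit polynomial of
   degree n over K', and has n distinct images under automorphisms that fix K'
   and the given invariant u; writing u = P(v) with deg P < n, P - u has n roots,
   so u lies in K'. For the last step the q^2 + 1 images of theta are theta and
   theta / l_{a,c}^(m (q-1)), where l_{a,c} = tau_{a,c}(w); they are distinct since
   1, z, z^r are linearly independent over K(x).

   K(t) contained in the fixed field: only the invariance of t under the
   involution is not immediate. The alternating form of (1, x, z, w) and its
   q^3-Frobenius image, D3 = w^(q^3) + w + x z^(q^3) + z x^(q^3), is a polynomial
   in d, namely d^(q+r+1) B(theta), so that t = D3^m / d^(q^3+1); the involution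
   divides D3 by w^(q^3+1) and d by w^m.

   The generators of Sz(q) exist as automorphisms because z has degree q over
   K(x), which is proved by exploiting the action of F_q^* on the curve. *)

Local Notation "p %:F" := (@FracField.tofrac _ p).

(** * Ring morphisms out of quotients and fraction fields *)

Lemma fraction_quotient (R : idomainType) (c : {fraction R}) :
  exists n d : R, d != 0 /\ c = n%:F / d%:F.
Proof.
elim/quotW: c => x; exists (\n_x), (\d_x); split; first exact: denom_ratioP.
have d0 : (\d_x)%:F != 0 :> {fraction R} by rewrite tofrac_eq0 denom_ratioP.
apply: (mulIf d0); rewrite mulfVK // /FracField.tofrac; unlock.
rewrite -[LHS]FracField.pi_mul; apply/eqmodP => /=; rewrite FracField.equivfE.
by rewrite /FracField.mulf !numden_Ratio ?mulr1 ?oner_neq0 ?denom_ratioP // mulrC.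
Qed.

(** The universal property of a quotient, with [A] playing the role of [R / ker phi]: any choice of
    preimages under [phi] gives the same value under [psi]. *)
Lemma rmorphism_factor (R A B : nzRingType)
    (phi : {rmorphism R -> A}) (psi : {rmorphism R -> B}) :
    (forall u, exists p, phi p = u) -> (forall p, phi p = 0 -> psi p = 0) ->
  exists f : {rmorphism A -> B}, forall p, f (phi p) = psi p.
Proof.
move=> sur ker.
have ex u : exists p, phi p == u by have [p <-] := sur u; exists p.
pose f u := psi (xchoose (ex u)).
have fE p : f (phi p) = psi p.
  apply/eqP; rewrite -subr_eq0 -rmorphB; apply/eqP/ker.
  by rewrite rmorphB /= (eqP (xchooseP (ex (phi p)))) subrr.
have fB : zmod_morphism f.
  move=> u v; have [p <-] := sur u; have [r <-] := sur v.
  by rewrite -rmorphB !fE rmorphB.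
have fM : monoid_morphism f.
  split=> [|u v]; first by rewrite -(rmorph1 phi) fE rmorph1.
  have [p <-] := sur u; have [r <-] := sur v.
  by rewrite -rmorphM !fE rmorphM.
pose faM := GRing.isZmodMorphism.Build _ _ _ fB.
pose fmM := GRing.isMonoidMorphism.Build _ _ _ fM.
pose g : {rmorphism A -> B} := HB.pack f faM fmM.
by exists g.
Qed.

(** Injectivity sends nonzero denominators to units, and cross-multiplication shows that the value
    does not depend on the chosen fraction. *)
Lemma fraction_extension (R : idomainType) (L : fieldType)
    (phi : {rmorphism R -> L}) :
    (forall p, phi p = 0 -> p = 0) ->
  exists f : {rmorphism {fraction R} -> L}, forall p, f p%:F = phi p.
Proof.
move=> inj.
have phi0 p : p != 0 -> phi p != 0 by apply: contra => /eqP/inj/eqP.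
have ex (c : {fraction R}) :
    exists p : R * R, (p.2 != 0) && (c == p.1%:F / p.2%:F).
  by have [n [d [d0 ->]]] := fraction_quotient c; exists (n, d); rewrite d0 /=.
pose f c := phi (xchoose (ex c)).1 / phi (xchoose (ex c)).2.
have fE n d : d != 0 -> f (n%:F / d%:F) = phi n / phi d.
  move=> d0; rewrite /f; have /andP[] := xchooseP (ex (n%:F / d%:F)).
  move: (xchoose _) => [n' d'] /= d'0.
  rewrite eqr_div ?tofrac_eq0 // -!rmorphM /= tofrac_eq => /eqP e.
  apply/eqP; rewrite eqr_div ?phi0 // -!rmorphM; apply/eqP; congr (phi _).
  by rewrite e.
have fB : zmod_morphism f.
  move=> u v; have [n [d [d0 ->]]] := fraction_quotient u.
  have [n' [d' [d'0 ->]]] := fraction_quotient v.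
  have F0 (e : R) : e != 0 -> e%:F != 0 by rewrite tofrac_eq0.
  rewrite -mulNr addf_div ?F0 // -rmorphN -!rmorphM -rmorphD /=.
  rewrite !fE ?mulf_neq0 // -[in RHS]mulNr addf_div ?phi0 //.
  by rewrite -rmorphN -!rmorphM -rmorphD.
have fM : monoid_morphism f.
  split=> [|u v].
    by rewrite -[1](divff (oner_neq0 _)) -tofrac1 fE ?oner_neq0 // divff ?phi0 ?oner_neq0.
  have [n [d [d0 ->]]] := fraction_quotient u.
  have [n' [d' [d'0 ->]]] := fraction_quotient v.
  by rewrite mulf_div -!rmorphM /= !fE ?mulf_neq0 // mulf_div -!rmorphM.
pose faM := GRing.isZmodMorphism.Build _ _ _ fB.
pose fmM := GRing.isMonoidMorphism.Build _ _ _ fM.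
pose g : {rmorphism {fraction R} -> L} := HB.pack f faM fmM.
exists g => p; rewrite -[RHS]divr1 -(rmorph1 phi) -fE ?oner_neq0 //.
by rewrite tofrac1 divr1.
Qed.

(** * Rational function fields and descent *)

Section RationalSubfield.
Variables (K L : fieldType) (iota : {rmorphism K -> L}).

(** Transcendence of [v] says that evaluation at [v] is injective, so it extends to fractions. *)
Lemma rational_embedding (v : L) : ~ algebraicOver iota v ->
  exists j : {rmorphism {fraction {poly K}} -> L},
    forall p, j p%:F = (map_poly iota p).[v].
Proof.
move=> tr.
have [|j jE] := @fraction_extension _ _
    (horner_eval v \o map_poly iota).
  move=> p /= p0; apply/eqP; apply/negP => /negP pn0; apply: tr.
  by exists p => //; apply/eqP.
by exists j.
Qed.

Lemma gen_add S u v : generated_subfield iota S u ->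
  generated_subfield iota S v -> generated_subfield iota S (u + v).
Proof.
move=> hu hv; rewrite -[v]opprK; apply: gen_sub => //.
by rewrite -sub0r -(rmorph0 iota); apply: gen_sub => //; apply: gen_const.
Qed.

Lemma gen_horner S (p : {poly K}) u : generated_subfield iota S u ->
  generated_subfield iota S (map_poly iota p).[u].
Proof.
move=> hu; elim/poly_ind: p => [|p c IH].
  by rewrite rmorph0 horner0 -(rmorph0 iota); apply: gen_const.
rewrite rmorphD rmorphM /= map_polyX map_polyC hornerMXaddC.
by apply: gen_add; [apply: gen_mul | apply: gen_const].
Qed.

Lemma gen_rational_embedding v (j : {rmorphism {fraction {poly K}} -> L}) :
    (forall p, j p%:F = (map_poly iota p).[v]) ->
  forall c, generated_subfield iota (fun u => u = v) (j c).
Proof.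
move=> jE c; have [n [d [_ ->]]] := fraction_quotient c.
by rewrite fmorph_div /= !jE; apply: gen_mul; [|apply: gen_inv];
  apply: gen_horner; apply: gen_elem.
Qed.

Lemma rmorphism_fix_generated (f : {rmorphism L -> L}) S :
    (forall c, f (iota c) = iota c) -> (forall u, S u -> f u = u) ->
  forall u, generated_subfield iota S u -> f u = u.
Proof.
move=> fK fS u; elim=> {u} [c|u /fS|u v _ eu _ ev|u v _ eu _ ev|u _ eu] //.
- by rewrite rmorphB eu ev.
- by rewrite rmorphM eu ev.
by rewrite fmorphV eu.
Qed.

(** Induction on the degree of an annihilator [P0] of [v]. If [P] is coprime to [P0], Bezout gives
    the inverse. Otherwise their gcd, dividing [P], does not vanish at [v], so its cofactor in [P0]
    is an annihilator of smaller degree. *)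
Lemma algebraic_inverse (v : L) (P : {poly K}) : algebraicOver iota v ->
  exists Q : {poly K}, ((map_poly iota P).[v])^-1 = (map_poly iota Q).[v].
Proof.
case=> P0; have [n] := ubnP (size P0); elim: n P0 => // n IH P0 szP0 P00 rP0.
have [Pv0|Pv] := eqVneq (map_poly iota P).[v] 0.
  by exists 0; rewrite Pv0 invr0 rmorph0 horner0.
have [cP|ncP] := boolP (coprimep P P0).
  have [[U V] /= UV] := Bezout_eq1_coprimepP _ _ cP; exists U.
  apply: (mulIf Pv); rewrite mulVf // -hornerM -rmorphM /=.
  have -> : U * P = 1 - V * P0 by rewrite -UV addrK.
  rewrite rmorphB rmorph1 rmorphM /= hornerD hornerN hornerM (eqP rP0).
  by rewrite mulr0 subr0 hornerE.
have /dvdpP[h hE] := dvdp_gcdr P P0; have /dvdpP[k kE] := dvdp_gcdl P P0.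
have P0E : (map_poly iota h).[v] * (map_poly iota (gcdp P P0)).[v] = 0.
  by rewrite -hornerM -rmorphM -hE (eqP rP0).
have gv : (map_poly iota (gcdp P P0)).[v] != 0.
  by apply: contra Pv => /eqP gv; rewrite kE rmorphM hornerM gv mulr0.
have h0 : h != 0 by apply: contra P00 => /eqP h0; rewrite hE h0 mul0r.
have g0 : gcdp P P0 != 0 by rewrite gcdp_eq0 (negPf P00) andbF.
apply: (IH h) => //; last first.
  by move/eqP: P0E; rewrite mulf_eq0 (negPf gv) orbF.
have: size P0 = (size h + size (gcdp P P0)).-1 by rewrite -size_mul // -hE.
have: (size (gcdp P P0) > 1)%N.
  by rewrite ltn_neqAle eq_sym [_ == _](negPf ncP) size_poly_gt0.
lia.
Qed.

Lemma generated_algebraic (v : L) (P0 : {poly K}) : P0 != 0 ->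
    root (map_poly iota P0) v ->
  forall u, generated_subfield iota (fun u => u = v) u ->
  exists2 P : {poly K}, (size P < size P0)%N & u = (map_poly iota P).[v].
Proof.
move=> P00 rP0 u gu.
suff [P ->] : exists P : {poly K}, u = (map_poly iota P).[v].
  exists (P %% P0); first by rewrite ltn_modp.
  by rewrite {1}(divp_eq P P0) rmorphD rmorphM hornerD hornerM (eqP rP0)
    mulr0 add0r.
elim: gu => {u} [c|u ->|u w _ [P ->] _ [Q ->]|u w _ [P ->] _ [Q ->]|u _ [P ->]].
- by exists c%:P; rewrite map_polyC hornerC.
- by exists 'X; rewrite map_polyX hornerX.
- by exists (P - Q); rewrite rmorphB hornerD hornerN.
- by exists (P * Q); rewrite rmorphM hornerM.
by apply: algebraic_inverse; exists P0.
Qed.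

(* Writing u = P(v) with deg P < n, the polynomial P - u vanishes at the n
   distinct conjugates of v, so it is zero. *)
Lemma fixed_descent (v u : L) (P0 : {poly K}) (rs : seq L) : P0 != 0 ->
    root (map_poly iota P0) v -> uniq rs -> (size P0 <= (size rs).+1)%N ->
    (forall v', v' \in rs -> exists f : {rmorphism L -> L},
       [/\ forall c, f (iota c) = iota c, f u = u & f v = v']) ->
    generated_subfield iota (fun u => u = v) u ->
  exists c, u = iota c.
Proof.
move=> P00 rP0 urs szrs conj /(generated_algebraic P00 rP0)[P szP uE].
have /eqP P0E : map_poly iota P - u%:P == 0.
  apply: contraLR (leq_trans szP szrs) => nz; rewrite -leqNgt.
  have szPu : (size (map_poly iota P - u%:P)%R <= maxn (size P) 1)%N.
    apply: leq_trans (size_polyD _ _) _.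
    by rewrite size_map_poly size_polyN geq_max leq_maxl leq_max
      size_polyC_leq1 orbT.
  have rs_lt : (size rs < size (map_poly iota P - u%:P)%R)%N.
    apply: max_poly_roots => //; apply/allP => v' /conj[f [fK fu fv]].
    rewrite rootE hornerD hornerN hornerC -fv.
    have -> : (map_poly iota P).[f v] = f (map_poly iota P).[v].
      by rewrite -horner_map -map_poly_comp (eq_map_poly (g := iota)).
    by rewrite -uE fu subrr.
  (* If [P] were zero, so would be [u] and [P - u]. Hence the bound [maxn (size P) 1] is just
     [size P]. *)
  have P_gt0 : (0 < size P)%N.
    rewrite size_poly_gt0; apply: contra nz => /eqP P0E.
    by rewrite uE P0E rmorph0 horner0 subr0.
  by rewrite (leq_trans rs_lt) // (leq_trans szPu) // geq_max leqnn.
exists P`_0; have /polyP/(_ 0%N) := P0E.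
by rewrite coefB coefC coef0 coef_map /= => /eqP; rewrite subr_eq0 => /eqP.
Qed.
End RationalSubfield.

(** * Algebraically closed constants and Frobenius powers *)

Lemma algebraicOver_closed (K : closedFieldType) (L : fieldType)
    (iota : {rmorphism K -> L}) (v : L) :
  algebraicOver iota v <-> exists c, v = iota c.
Proof.
split=> [[p p0]|[c ->]]; last first.
  exists ('X - c%:P); first by rewrite -size_poly_eq0 size_XsubC.
  by rewrite rootE rmorphB /= map_polyX map_polyC !hornerE subrr.
have [rs rsE] := closed_field_poly_normal p.
rewrite rsE linearZ rmorph_prod /= rootZ ?fmorph_eq0 ?lead_coef_eq0 //.
under eq_bigr do rewrite rmorphB /= map_polyX map_polyC.
rewrite -(big_map iota xpredT (fun c => 'X - c%:P)) root_prod_XsubC.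
by case/mapP=> c _ ->; exists c.
Qed.

(** This enumerates the subfield of order [2 ^ n]. The roots of [T^q - T] are distinct because its
    derivative is the constant -1. *)
Lemma fixed_Frobenius (K : closedFieldType) n : 2%N \in [pchar K] -> (0 < n)%N ->
  exists rs : seq K, [/\ uniq rs, size rs = (2 ^ n)%N &
    forall c, (c \in rs) = (c ^+ (2 ^ n) == c)].
Proof.
move=> ch n0; set q := (2 ^ n)%N.
have q1 : (1 < q)%N by rewrite -{1}(expn0 2) ltn_exp2l.
have szp : size ('X^q - 'X : {poly K}) = q.+1.
  by rewrite size_polyDl size_polyXn // size_polyN size_polyX.
have [rs rsE] := closed_field_poly_normal ('X^q - 'X : {poly K}).
have p0 : lead_coef ('X^q - 'X : {poly K}) != 0.
  by rewrite lead_coef_eq0 -size_poly_gt0 szp.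
exists rs; split.
- rewrite -separable_prod_XsubC -(eqp_separable (p := 'X^q - 'X)); last first.
    by rewrite rsE eqp_scale.
  have q0 : q%:R = 0 :> K.
    by rewrite natrX (pcharf0 ch) expr0n (gtn_eqF n0).
  rewrite unlock derivB derivXn derivX -scaler_nat q0 scale0r sub0r.
  by rewrite -[- 1]scaleN1r coprimepZr ?coprimep1 // oppr_eq0 oner_eq0.
- by apply/eqP; rewrite -eqSS -szp rsE size_scale // size_prod_XsubC.
move=> c; rewrite -root_prod_XsubC -(rootZ _ _ p0) -rsE.
by rewrite rootE !hornerE subr_eq0.
Qed.

Lemma exprD_char2 (R : comNzRingType) n (u v : R) : 2%N \in [pchar R] ->
  (u + v) ^+ (2 ^ n) = u ^+ (2 ^ n) + v ^+ (2 ^ n).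
Proof.
move=> ch; apply: exprDn_pchar.
by rewrite (eq_pnat _ (pcharf_eq ch)) pnatX.
Qed.

(** A translation preserves the leading coefficient, so the associates are equal. *)
Lemma eqp_shift (R : fieldType) (A : {poly R}) c :
  A %= A \Po ('X + c%:P) -> A \Po ('X + c%:P) = A.
Proof.
have [->|A0] := eqVneq A 0; first by rewrite comp_poly0.
move=> /eqp_eq; rewrite lead_coef_comp ?size_XaddC //.
rewrite (monicP (monicXaddC _)) expr1n mulr1.
move/(congr1 ( *:%R (lead_coef A)^-1)).
by rewrite !scalerA mulVf ?lead_coef_eq0 // !scale1r.
Qed.

(** * Irreducibility of the Suzuki equation over K(x) *)

Section SuzukiParameters.
Variables (s q r : nat).
Hypotheses (s_gt0 : (0 < s)%N).
Hypotheses (qE : q = (2 ^ (2 * s + 1))%N) (rE : r = (2 ^ s.+1)%N).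

Lemma suzuki_r_sqr : (r * r = 2 * q)%N.
Proof. by rewrite qE rE -expnD -expnS addn1 mul2n -addnn addnS addSn. Qed.

Lemma suzuki_r_gt3 : (3 < r)%N.
Proof. by rewrite rE (@leq_exp2l 2 2). Qed.

Lemma suzuki_r_lt_q : (r.+1 < q)%N.
Proof. by move: suzuki_r_sqr suzuki_r_gt3; nia. Qed.

(** The product is [(q + 1)^2 - r^2], and [r^2 = 2 q]. *)
Lemma suzuki_norm : ((q + r + 1) * (q - r + 1) = q ^ 2 + 1)%N.
Proof. by move: suzuki_r_sqr suzuki_r_lt_q; nia. Qed.
End SuzukiParameters.

Section Irreducibility.
Variables (K : closedFieldType) (L : fieldType) (s q r : nat).
Hypotheses (ch : 2%N \in [pchar K]) (s_gt0 : (0 < s)%N).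
Hypotheses (qE : q = (2 ^ (2 * s + 1))%N) (rE : r = (2 ^ s.+1)%N).

Let r_sqr := suzuki_r_sqr qE rE.
Let r_gt3 := suzuki_r_gt3 s_gt0 rE.
Let r_lt_q := suzuki_r_lt_q s_gt0 qE rE.
Let q_gt1 : (1 < q)%N. Proof. by apply: leq_trans r_lt_q. Qed.

(** The field [M] stands for K(T). The argument relies only on the scalings of [T] ([twist]) and on
    [z] lying outside [M]. *)
Section AbstractBase.
Variables (M : fieldType) (cst : {rmorphism K -> M}) (T : M).
Variables (j : {rmorphism M -> L}) (z : L).
Local Notation fX := (T ^+ (q + r) + T ^+ r.+1).
Local Notation P0 := ('X^q + 'X - fX%:P).
Local Notation tr c := ('X + (cst c)%:P).
Hypothesis hz : z ^+ q + z = j fX.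
Hypothesis twist : forall d : K, d != 0 -> exists psi : {rmorphism M -> M},
  psi T = cst d * T /\ forall c, psi (cst c) = cst c.
Hypothesis not_rational : ~ exists g, z = j g.

Let chL : 2%N \in [pchar L].
Proof. by apply: (rmorph_pchar (j \o cst)). Qed.

Let size_tail : (size ('X - fX%:P : {poly M})%R <= q)%N.
Proof.
rewrite (leq_trans (size_polyD _ _)) // size_polyX size_polyN geq_max q_gt1.
by rewrite (leq_trans (size_polyC_leq1 _)) // ltnW.
Qed.

Let size_P0 : size (P0 : {poly M}) = q.+1.
Proof. by rewrite -addrA size_polyDl size_polyXn. Qed.

Let monic_P0 : (P0 : {poly M}) \is monic.
Proof. by rewrite monicE -addrA lead_coefDl ?lead_coefXn // size_polyXn. Qed.

Let rootP0 c : c ^+ q = c -> root (map_poly j P0) (z + j (cst c)).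
Proof.
move=> cq; rewrite rootE !rmorphB /= rmorphD /= map_polyXn map_polyX map_polyC.
rewrite !hornerE subr_eq0 -[X in _ == X]hz qE exprD_char2 // -qE.
rewrite -!rmorphXn cq /=.
by rewrite -addrA addrACA (addrr_pchar2 chL) addr0.
Qed.

(** Over [L], the polynomial [P0] is the product of the [Y - (z + c)] for c in F_q, so a divisor
    corresponds to a subset of F_q. *)
Lemma divisor_roots (B : {poly M}) : B %| P0 ->
  exists cs : seq K, [/\ uniq cs, size B = (size cs).+1,
    forall c, c \in cs -> c ^+ q = c &
    forall c, c \in cs -> (map_poly j B).[z + j (cst c)] = 0].
Proof.
move=> dvB; have e0 : (0 < 2 * s + 1)%N by rewrite addn1.
have [rs [urs szrs rsP]] := fixed_Frobenius ch e0; rewrite -qE in szrs rsP.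
have inj : injective (fun c => z + j (cst c)).
  by move=> c d /addrI/fmorph_inj/fmorph_inj.
have P0E : map_poly j P0 = \prod_(c <- rs) ('X - (z + j (cst c))%:P).
  rewrite -(big_map (fun c => z + j (cst c)) xpredT (fun u => 'X - u%:P)).
  rewrite -[RHS]scale1r; have -> : 1 = lead_coef (map_poly j P0).
    by rewrite lead_coef_map (monicP monic_P0) rmorph1.
  apply: all_roots_prod_XsubC.
  - by rewrite size_map_poly size_P0 size_map szrs.
  - apply/allP => _ /mapP[c /[!rsP]/eqP cq ->]; exact: rootP0.
  by rewrite uniq_rootsE map_inj_uniq.
have : map_poly j B %| \prod_(c <- rs) ('X - (z + j (cst c))%:P).
  by rewrite -P0E dvdp_map.
case/dvdp_prod_XsubC=> m Bm; exists (mask m rs); split.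
- exact: mask_uniq.
- by rewrite -(size_map_poly j) (eqp_size Bm) size_prod_XsubC.
- by move=> c /mem_mask; rewrite rsP => /eqP.
move=> c cm; apply/eqP; rewrite -rootE (eqp_root Bm).
rewrite -(big_map (fun c => z + j (cst c)) xpredT (fun u => 'X - u%:P)).
by rewrite root_prod_XsubC; apply/mapP; exists c.
Qed.

(* Let A be a nonzero polynomial of least degree vanishing at z; it divides
   Y^q + Y - f, whose roots are the z + c with c in F_q. The set of those c for
   which A(Y + c) = A(Y) is an additive group. The substitution X := d X, for
   d in F_q^*, multiplies f by d^(r+1), and so maps A, after rescaling Y, to
   another factor of Y^q + Y - f, i.e., to a translate of A: hence the group is
   stable under multiplication by d^(r+1), which is an arbitrary element of
   F_q^* since (r+1)(r-1) = 2(q-1)+1. As deg A > 1 it is not trivial, so it is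
   F_q, and deg A >= q. *)
Lemma linear_independence (A : {poly M}) :
  (size A <= q)%N -> (map_poly j A).[z] = 0 -> A = 0.
Proof.
have [n] := ubnP (size A); elim: n A => // n IH A szn szA Az.
apply/eqP; apply/negPn/negP => A0.
have Amin B : (map_poly j B).[z] = 0 -> A %| B.
  move=> Bz; have szM : (size (B %% A)%R < size A)%N by rewrite ltn_modp.
  apply/modp_eq0P/IH; first exact: leq_trans szM szn.
    by rewrite (leq_trans (ltnW szM)).
  move: Bz; rewrite {1}(divp_eq B A) rmorphD rmorphM hornerD hornerM Az mulr0.
  by rewrite add0r.
have Ashift (B : {poly M}) (c : K) : size B = size A ->
    (map_poly j B).[z + j (cst c)] = 0 -> A %= B \Po tr c.
  move=> szB Bz; rewrite -dvdp_size_eqp ?size_comp_poly2 ?size_XaddC ?szB //.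
  apply: Amin; rewrite map_comp_poly horner_comp rmorphD /= map_polyX.
  by rewrite map_polyC !hornerE.
have not_const : size A != 1.
  apply/negP => /size_poly1P[c c0 AE].
  by move: Az; rewrite AE map_polyC hornerC => /eqP; rewrite fmorph_eq0 (negPf c0).
have [c1 [c1q c10 c1A]] : exists c : K, [/\ c ^+ q = c, c != 0 & A \Po tr c = A].
  have AP0 : A %| P0.
    by apply: Amin; have := @rootP0 0; rewrite expr0n gtn_eqF ?(ltnW q_gt1) //
      => /(_ erefl)/eqP; rewrite !rmorph0 addr0.
  have [cs [ucs szcs csq csA]] := divisor_roots AP0.
  (* No root would make [A] constant and a single root would make it linear, putting [z] in [M]. Of
     two distinct roots, at least one is nonzero. *)
  have [c ccs c0] : exists2 c, c \in cs & c != 0.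
    case: cs ucs szcs {csq csA} => [_ /eqP|c [_ szA2|d cs]].
    - by rewrite (negPf not_const).
    - exfalso; apply: not_rational; exists (- A`_0 / A`_1).
      have A1 : A`_1 != 0 by move: A0; rewrite -lead_coef_eq0 lead_coefE szA2.
      move: Az; rewrite horner_coef size_map_poly szA2 !big_ord_recl big_ord0 /=.
      rewrite expr0 mulr1 expr1 addr0 !coef_map /= => Az.
      rewrite fmorph_div rmorphN; apply: (mulIf (_ : j A`_1 != 0)).
        by rewrite fmorph_eq0.
      rewrite mulfVK ?fmorph_eq0 // mulrC; apply/eqP.
      by rewrite -subr_eq0 opprK addrC Az.
    case/andP=> cd _ _; have [c0|] := eqVneq c 0; last by exists c; rewrite ?mem_head.
    exists d; first by rewrite !inE eqxx orbT.
    by move: cd; rewrite c0 inE negb_or eq_sym => /andP[].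
  exists c; split; [exact: csq | exact: c0 |].
  by apply/eqp_shift/Ashift => //; apply: csA.
have Fq_shift b : b ^+ q = b -> (map_poly j A).[z + j (cst b)] = 0.
  move=> bq; have [->|b0] := eqVneq b 0; first by rewrite !rmorph0 addr0.
  suff bA : A \Po tr b = A.
    have := Az; rewrite -{1}bA map_comp_poly horner_comp rmorphD /= map_polyX.
    by rewrite map_polyC !hornerE.
  (* This [d] satisfies [d^(r+1) = u], so scaling by [d^(r+1)] carries the shift [b] to the known
     shift [c1]. *)
  pose u := c1 / b; pose d := u ^+ r.-1.
  have u0 : u != 0 by rewrite mulf_neq0 ?invr_eq0.
  have uq : u ^+ q = u by rewrite exprMn exprVn c1q bq.
  have dq : d ^+ q = d by rewrite exprAC uq.
  have d0 : d != 0 by rewrite expf_neq0.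
  have dr : d ^+ r.+1 * b = c1.
    rewrite -exprM; have -> : (r.-1 * r.+1 = q + q.-1)%N.
      by move: r_sqr q_gt1 r_gt3; case: (r) => // r'; rewrite mulnS mulSn /=; lia.
    by rewrite exprD uq -exprS (prednK (ltnW q_gt1)) uq mulfVK.
  have [psi [psiT psic]] := twist d0.
  pose D := cst (d ^+ r.+1).
  have D0 : D != 0 by rewrite fmorph_eq0 expf_neq0.
  have sizeDX : size (D *: 'X : {poly M}) = 2 by rewrite size_scale ?size_polyX.
  pose A' := map_poly psi A \Po (D *: 'X).
  have szA' : size A' = size A by rewrite size_comp_poly2 ?size_map_poly.
  have psif : psi fX = D * fX.
    rewrite rmorphD !rmorphXn /= psiT !exprMn -!rmorphXn mulrDr.
    by rewrite exprD dq -exprS.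
  have P0_twist (f : M) : psi f = D * f -> 'X^q + 'X - f%:P =
      D^-1 *: (map_poly psi ('X^q + 'X - f%:P) \Po (D *: 'X)).
    move=> psif'.
    have -> : map_poly psi ('X^q + 'X - f%:P) = 'X^q + 'X - (D * f)%:P.
      by rewrite rmorphB rmorphD /= map_polyXn map_polyX map_polyC /= psif'.
    rewrite comp_polyB comp_polyD comp_polyC comp_polyX comp_Xn_poly.
    have Dq : D ^+ q = D by rewrite -rmorphXn exprAC dq.
    rewrite exprZn Dq -scalerDr polyCM mul_polyC -scalerBr scalerA.
    by rewrite mulVf // scale1r.
  have A'P0 : A' %| P0.
    rewrite (P0_twist _ psif).
    rewrite dvdpZr ?invr_eq0 //; apply: dvdp_comp_poly.
    rewrite dvdp_map; apply: Amin; apply/eqP; rewrite -rootE.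
    by have := @rootP0 0; rewrite !rmorph0 addr0 expr0n gtn_eqF ?(ltnW q_gt1) //; apply.
  have [[|e cs] [_ szcs csq csA']] := divisor_roots A'P0.
    by have := not_const; rewrite -szA' szcs.
  have AA' : A %= A' \Po tr e by apply: Ashift => //; apply: csA'; rewrite mem_head.
  (* Since [A'(Y) = (psi A)(D Y)] and [D b = c1], shifting [A'] by [b] shifts [psi A] by [c1]. This
     changes nothing, as [psi] fixes constants. *)
  have A'tr : (A' \Po tr e) \Po tr b = A' \Po tr e.
    have psiA : map_poly psi A \Po tr c1 = map_poly psi A.
      by rewrite -[in RHS]c1A map_comp_poly rmorphD /= map_polyX map_polyC /= psic.
    rewrite /A' -[X in _ = (X \Po _) \Po _]psiA -!comp_polyA; congr (_ \Po _).
    rewrite !(comp_polyD, comp_polyX, comp_polyC, comp_polyZ) -addrA.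
    rewrite !scalerDr -addrA; congr (_ + _).
    by rewrite -dr rmorphM /= -mul_polyC -polyCM addrC.
  apply: eqp_shift; apply: (eqp_trans AA'); rewrite -A'tr eqp_sym.
  by case/andP: AA' => ? ?; rewrite /eqp !dvdp_comp_poly.
have e0 : (0 < 2 * s + 1)%N by rewrite addn1.
have [rs [urs szrs rsP]] := fixed_Frobenius ch e0; rewrite -qE in szrs rsP.
have : (q < size A)%N; last by rewrite ltnNge szA.
rewrite -(size_map_poly j) -szrs -(size_map (fun c => z + j (cst c))).
apply: max_poly_roots; first by rewrite map_poly_eq0.
  by apply/allP=> _ /mapP[c /[!rsP] /eqP cq ->]; apply/eqP/Fq_shift.
by rewrite map_inj_uniq // => c d /addrI/fmorph_inj/fmorph_inj.
Qed.
End AbstractBase.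

Local Notation M := {fraction {poly K}}.
Local Notation T := ('X%:F : M).
Local Notation cst := (@FracField.tofrac {poly K} \o polyC).
Variables (j : {rmorphism M -> L}) (z : L).
Local Notation fX := (T ^+ (q + r) + T ^+ r.+1).
Hypothesis hz : z ^+ q + z = j fX.

(** Clearing denominators in [g = n / d] gives an equation whose right side has degree
    [q + r + q deg d]. The left side can reach this degree only through [n^q], so [q] would divide
    [r], although [0 < r < q]. *)
Lemma suzuki_z_not_rational : ~ exists g, z = j g.
Proof.
case=> g zE; have gE : g ^+ q + g = fX.
  by apply: (fmorph_inj j); rewrite rmorphD rmorphXn -zE hz.
have [n [d [d0 gnd]]] := fraction_quotient g.
have dF0 : d%:F != 0 by rewrite tofrac_eq0.
have : n ^+ q + n * d ^+ q.-1 = ('X ^+ (q + r) + 'X ^+ r.+1) * d ^+ q.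
  apply/eqP; rewrite -tofrac_eq !(tofracD, tofracM, tofracXn); apply/eqP.
  rewrite -gE gnd mulrDl -exprMn mulfVK //; congr (_ + _).
  by rewrite -{2}(prednK (ltnW q_gt1)) exprS mulrA mulfVK.
move/(congr1 (fun p : {poly K} => (size p).-1)) => sz.
have szX : size ('X ^+ (q + r) + 'X ^+ r.+1 : {poly K}) = (q + r).+1.
  by rewrite size_polyDl !size_polyXn // !ltnS; move: q_gt1; lia.
have szR : (size (('X ^+ (q + r) + 'X ^+ r.+1) * d ^+ q)%R).-1 =
    (q + r + (size d).-1 * q)%N.
  have dq0 : d ^+ q != 0 by rewrite expf_neq0.
  rewrite size_mul // -?size_poly_eq0 ?szX //.
  rewrite addSn /= -(prednK (_ : 0 < size (d ^+ q)))%N ?size_poly_gt0 //.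
  by rewrite addnS /= size_exp.
have dqE : (size (d ^+ q.-1)).-1 = ((size d).-1 * q.-1)%N by rewrite size_exp.
have nqE : (size (n ^+ q)).-1 = ((size n).-1 * q)%N by rewrite size_exp.
rewrite szR in sz.
have szM : (size (n * d ^+ q.-1)%R <= (size n).-1 + (size d).-1 * q.-1 + 1)%N.
  by rewrite (leq_trans (size_polyMleq _ _)) // -dqE;
    move: (size n) (size _) => a b; lia.
have := size_polyD (n ^+ q) (n * d ^+ q.-1); rewrite leq_max => szD.
have szlt : (size (n * d ^+ q.-1)%R < size (n ^+ q))%N.
  move: sz szM nqE szD; move: (size n).-1 (size d).-1 (size (n ^+ q)).
  move: (size (n * d ^+ q.-1)) (size (n ^+ q + n * d ^+ q.-1)) => M1 S al be N1.
  case: q q_gt1 => // q' q'1 /=; have [le_ab|lt_ba] := leqP al be.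
    have := leq_mul le_ab (leqnn q'); rewrite !mulnS; lia.
  have := leq_mul lt_ba (leqnn q'); rewrite !mulnS !mulSn; lia.
rewrite size_polyDl // nqE in sz.
have : (q %| q + r + (size d).-1 * q)%N by rewrite -{}sz dvdn_mull.
rewrite (dvdn_addl _ (dvdn_mull _ (dvdnn q))) (dvdn_addr _ (dvdnn q)).
move/dvdn_leq => /(_ (leq_trans (isT : (0 < 4)%N) r_gt3)).
by rewrite leqNgt (ltnW r_lt_q).
Qed.

Lemma fraction_scaling d : d != 0 -> exists psi : {rmorphism M -> M},
  psi T = cst d * T /\ forall c, psi (cst c) = cst c.
Proof.
move=> d0; have szd : size (d *: 'X : {poly K}) = 2 by rewrite size_scale ?size_polyX.
have [|psi psiE] := @fraction_extension _ _
  (@FracField.tofrac {poly K} \o comp_poly (d *: 'X)).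
  by move=> p /eqP /=; rewrite tofrac_eq0 comp_poly_eq0 ?szd // => /eqP.
exists psi; split=> [|c]; rewrite /= psiE /=.
  by rewrite comp_polyX -mul_polyC rmorphM.
by rewrite comp_polyC.
Qed.
End Irreducibility.

(* [ring] does not know that 2 = 0: each witness e is half the difference of the
   two sides expanded over the integers. *)
Lemma eq_pchar2 (R : comNzRingType) (ch : 2%N \in [pchar R]) (e u v : R) :
  u = v + 2%:R * e -> u = v.
Proof. by rewrite (pcharf0 ch) mul0r addr0. Qed.

(** * The coordinate w and the Frobenius form *)

Section SuzukiIdentities.
Variables (F : fieldType) (s q r : nat) (x z d w : F).
Hypotheses (ch : 2%N \in [pchar F]) (s_gt0 : (0 < s)%N).
Hypotheses (qE : q = (2 ^ (2 * s + 1))%N) (rE : r = (2 ^ s.+1)%N).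
Local Notation X := (x ^+ r).
Local Notation Z := (z ^+ r).
Hypotheses (xq : x ^+ q = x + d) (zq : z ^+ q = z + X * d).
Hypotheses (wE : w = x * z + x ^+ 2 * X + Z) (w0 : w != 0).

Local Notation m := (q - r + 1)%N.

Lemma exprD_q (u v : F) : (u + v) ^+ q = u ^+ q + v ^+ q.
Proof. by rewrite qE exprD_char2. Qed.

Lemma exprD_r (u v : F) : (u + v) ^+ r = u ^+ r + v ^+ r.
Proof. by rewrite rE exprD_char2. Qed.

Lemma expr_rr (u : F) : (u ^+ r) ^+ r = (u ^+ q) ^+ 2.
Proof. by rewrite -!exprM (suzuki_r_sqr qE rE) mulnC. Qed.

Let Xr : X ^+ r = (x + d) ^+ 2. Proof. by rewrite expr_rr -xq. Qed.
Let Zr : Z ^+ r = (z + X * d) ^+ 2. Proof. by rewrite expr_rr zq. Qed.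
Let Xq : X ^+ q = X + d ^+ r. Proof. by rewrite exprAC xq exprD_r. Qed.

(** As [r^2 = 2 q], the r-th powers of [X] and [Z] are the squares of [x^q] and [z^q]. *)
Lemma suzuki_w_expr_r : w ^+ r = X * Z + z ^+ 2 + x ^+ 2 * X ^+ 2.
Proof.
rewrite wE !exprD_r !exprMn Zr Xr.
move: X Z => X Z.
by apply: (eq_pchar2 ch (e := X ^+ 2 * d * x + X ^+ 2 * d ^+ 2 + X * d * z)); ring.
Qed.

Lemma suzuki_w_expr_q : w ^+ q = w + (z + x * X) * d.
Proof.
rewrite wE !exprD_q !exprMn [Z ^+ q]exprAC zq xq Xq.
rewrite exprD_r exprMn Xr.
move: X Z (d ^+ r) => X Z D.
apply: (eq_pchar2 ch (e := X * d * x + X * d ^+ 2 + D * x ^+ 2 +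
  2%:R * D * d * x + D * d ^+ 2)); ring.
Qed.

Let m_r : (m + r = q.+1)%N.
Proof. by have := suzuki_r_lt_q s_gt0 qE rE; lia. Qed.

(** The numerator over [w^(q+1)] is [d w^r], and [q + 1 = m + r]. *)
Lemma delta_involution : (z / w) ^+ q + z / w = d / w ^+ m.
Proof.
rewrite expr_div_n addf_div ?expf_neq0 //.
have -> : z ^+ q * w + z * w ^+ q = d * w ^+ r.
  rewrite suzuki_w_expr_q suzuki_w_expr_r wE zq; move: X Z => X Z.
  by apply: (eq_pchar2 ch (e := x * z ^+ 2 + X * x ^+ 2 * z + Z * z + X * d * x * z)); ring.
by rewrite -exprSr -m_r exprD -mulf_div divff ?mulr1 ?expf_neq0.
Qed.

(** The pair [(z / w, x / w)] lies on the same curve as [(x, z)], as needed to define the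
    involution. *)
Lemma involution_equation :
  (x / w) ^+ q + x / w = (z / w) ^+ r * ((z / w) ^+ q + z / w).
Proof.
rewrite delta_involution !expr_div_n addf_div ?expf_neq0 //.
have -> : x ^+ q * w + x * w ^+ q = Z * d.
  rewrite suzuki_w_expr_q wE xq; move: X Z => X Z.
  by apply: (eq_pchar2 ch (e := x ^+ 2 * z + X * x ^+ 3 + Z * x + d * x * z
    + X * d * x ^+ 2)); ring.
by rewrite -exprSr -m_r addnC exprD mulf_div.
Qed.

Lemma w_involution :
  z / w * (x / w) + (z / w) ^+ 2 * (z / w) ^+ r + (x / w) ^+ r = w^-1.
Proof.
have wr0 : w ^+ r != 0 by rewrite expf_neq0.
have num : x * z * w ^+ r + z ^+ 2 * Z + X * w ^+ 2 = w * w ^+ r.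
  rewrite suzuki_w_expr_r wE; move: X Z => X Z.
  by apply: (eq_pchar2 ch (e := X * Z * x * z + X ^+ 2 * x ^+ 3 * z)); ring.
rewrite !expr_div_n; move: (w ^+ r) wr0 num => wr wr0 num.
transitivity ((w * wr) / (w ^+ 2 * wr)); last by field; rewrite w0 wr0.
by rewrite -num; field; rewrite w0 wr0.
Qed.

Local Notation D3 := (w ^+ (q ^ 3) + w + x * z ^+ (q ^ 3) + z * x ^+ (q ^ 3)).

(** Iterating the q-Frobenius writes the [q^3]-th powers of [x], [z] and [w] through [x], [z] and
    powers of [d]. In the alternating combination every term containing [x] or [z] cancels. *)
Lemma frobenius_form : D3 = d ^+ (q + r + 1) + d ^+ (q ^ 2 + r + 1)
  + d ^+ (q * (q + r) + 1) + d ^+ (q * (q + r + 1)).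
Proof.
set d1 := d ^+ q; set d2 := d1 ^+ q; set D := d ^+ r; set D1 := d1 ^+ r.
have DE : D ^+ q = D1 by rewrite exprAC.
have q3 (u : F) : u ^+ (q ^ 3) = ((u ^+ q) ^+ q) ^+ q.
  by rewrite -!exprM; congr (_ ^+ _); lia.
have x3 : x ^+ (q ^ 3) = x + d + d1 + d2.
  by rewrite q3 !(xq, exprD_q).
have z3 : z ^+ (q ^ 3) = z + X * d + (X + D) * d1 + (X + D + D1) * d2.
  by rewrite q3 zq !(exprD_q, exprMn, zq, Xq) DE.
have Yq : (z + x * X) ^+ q = z + x * X + (x + d) * D.
  rewrite exprD_q exprMn zq xq Xq -/D; move: X => X.
  by apply: (eq_pchar2 ch (e := X * d)); ring.
have w3 : w ^+ (q ^ 3) = w + (z + x * X) * d + (z + x * X + (x + d) * D) * d1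
    + (z + x * X + (x + d) * D + (x + d + d1) * D1) * d2.
  have w2 : (w ^+ q) ^+ q = w + (z + x * X) * d + (z + x * X + (x + d) * D) * d1.
    by rewrite suzuki_w_expr_q exprD_q suzuki_w_expr_q exprMn Yq.
  rewrite q3 w2 2!exprD_q suzuki_w_expr_q !exprMn (exprD_q (z + x * X)) exprMn Yq.
  by rewrite exprD_q xq DE.
have -> : d ^+ (q + r + 1) = d * D * d1.
  by rewrite -exprS -exprD; congr (_ ^+ _); lia.
have -> : d ^+ (q ^ 2 + r + 1) = d * D * d2.
  by rewrite -exprS /d2 -exprM -exprD; congr (_ ^+ _); lia.
have -> : d ^+ (q * (q + r) + 1) = d * D1 * d2.
  by rewrite /D1 /d2 -!exprM -exprS -exprD; congr (_ ^+ _); nia.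
have -> : d ^+ (q * (q + r + 1)) = d1 * D1 * d2.
  by rewrite /D1 /d2 -!exprM -!exprD; congr (_ ^+ _); nia.
rewrite x3 z3 w3 wE; move: X Z => X Z.
apply: (eq_pchar2 ch (e := 2%:R * x * z + X * x ^+ 2 + Z + d * z + X * d * x
  + d1 * z + X * d1 * x + D * d1 * x + d2 * z + X * d2 * x + D * d2 * x
  + D1 * d2 * x)); ring.
Qed.
End SuzukiIdentities.

(** * The rational function field and descent along its extensions *)

(** The existential hides the construction of K(T). It retains the embedding onto K(v) for each
    transcendental [v], and the fact that a solution [z] of the Suzuki equation has degree at least
    [q] over K(T). *)
Lemma rational_function_field (K : closedFieldType) :
  exists (M : fieldType) (cst : {rmorphism K -> M}) (T : M),
  [/\ forall (L : fieldType) (iota : {rmorphism K -> L}) v,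
        ~ algebraicOver iota v ->
        exists j : {rmorphism M -> L}, [/\ forall c, j (cst c) = iota c, j T = v
          & forall c, generated_subfield iota (fun u => u = v) (j c)]
    & forall (L : fieldType) s q r (j : {rmorphism M -> L}) z,
        2%N \in [pchar K] -> (0 < s)%N -> q = (2 ^ (2 * s + 1))%N ->
        r = (2 ^ s.+1)%N -> z ^+ q + z = j (T ^+ (q + r) + T ^+ r.+1) ->
        forall A : {poly M}, (size A <= q)%N -> (map_poly j A).[z] = 0 -> A = 0].
Proof.
exists {fraction {poly K}}, (@FracField.tofrac {poly K} \o polyC).
exists (@FracField.tofrac {poly K} 'X); split=> [L iota v tr|L s q r j z].
  have [j jE] := rational_embedding tr; exists j.
  split=> [c||]; last exact: gen_rational_embedding.
    by rewrite /= jE map_polyC hornerC.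
  by rewrite jE map_polyX hornerX.
move=> ch s0 qE rE hz; apply: (linear_independence ch s0 qE rE hz).
  by move=> d d0; apply: fraction_scaling d0.
exact (suzuki_z_not_rational ch s0 qE rE hz).
Qed.

Lemma gen_monotone (K M F : fieldType) (iota : {rmorphism K -> F})
    (j : {rmorphism M -> F}) (S S' : F -> Prop) :
    (forall c, generated_subfield j S' (iota c)) ->
    (forall u, S u -> generated_subfield j S' u) ->
  forall u, generated_subfield iota S u -> generated_subfield j S' u.
Proof.
move=> hc hS u; elim=> {u} [c|u /hS|u v _ ? _ ?|u v _ ? _ ?|u _ ?] //.
- exact: gen_sub.
- exact: gen_mul.
exact: gen_inv.
Qed.

(** If the value were algebraic it would be a constant [c], making [v] a root of the nonzero
    polynomial [p - c]. *)
Lemma transcendental_poly (K : closedFieldType) (F : fieldType)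
    (iota : {rmorphism K -> F}) v (p : {poly K}) :
    ~ algebraicOver iota v -> (1 < size p)%N ->
  ~ algebraicOver iota (map_poly iota p).[v].
Proof.
move=> tr szp /algebraicOver_closed[c pc]; apply: tr; exists (p - c%:P).
  apply: contraTneq szp => /eqP; rewrite subr_eq0 => /eqP ->.
  by rewrite -leqNgt size_polyC_leq1.
by rewrite rootE rmorphB /= map_polyC !hornerE pc subrr.
Qed.

(** Here [v] is a root of [A - t B] over K(t), of degree [deg A] because [B] has smaller degree. The
    list [rs] supplies as many conjugates of [v]. *)
Lemma descent_step (K : closedFieldType) (F : fieldType)
    (iota : {rmorphism K -> F}) (t v u : F) (A B : {poly K}) (rs : seq F) :
    ~ algebraicOver iota t -> (size B < size A)%N ->
    (map_poly iota A).[v] = t * (map_poly iota B).[v] ->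
    uniq rs -> (size A <= (size rs).+1)%N ->
    (forall v', v' \in rs -> exists f : {rmorphism F -> F},
      [/\ forall c, f (iota c) = iota c, f t = t, f u = u & f v = v']) ->
  generated_subfield iota (fun u => u = v) u ->
  generated_subfield iota (fun u => u = t) u.
Proof.
move=> tr szBA AB urs szrs conj gu.
have [M [cst [T [emb _]]]] := rational_function_field K.
have [j [jc jT jgen]] := emb _ _ _ tr.
have jcE p : map_poly j (map_poly cst p) = map_poly iota p.
  by rewrite -map_poly_comp; apply: eq_map_poly.
have szP0 : size (map_poly cst A - T *: map_poly cst B) = size A.
  rewrite size_polyDl size_map_poly // size_polyN (leq_ltn_trans (size_scale_leq _ _)) //.
  by rewrite size_map_poly.
have [c ->] : exists c, u = j c; last exact: jgen.
apply: (fixed_descent (v := v) (P0 := map_poly cst A - T *: map_poly cst B) _ _ urs).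
- by rewrite -size_poly_gt0 szP0 (leq_ltn_trans (leq0n _) szBA).
- by rewrite rootE rmorphB /= map_polyZ !jcE hornerD hornerN hornerZ AB jT subrr.
- by rewrite szP0.
- move=> v' /conj[f [fc ft fu fv]]; exists f; split=> // b.
  by apply: (rmorphism_fix_generated fc _ (jgen b)) => _ ->.
apply: gen_monotone gu => [c|_ ->]; last exact: gen_elem.
by rewrite -jc; apply: gen_const.
Qed.

(** * Automorphisms of the Suzuki function field *)

Section SuzukiField.
Variables (K : closedFieldType) (F : fieldType) (iota : {rmorphism K -> F}).
Variables (s q0 q : nat) (x y : F).
Hypotheses (chK : 2%N \in [pchar K]) (s_gt0 : (0 < s)%N).
Hypotheses (q0E : q0 = (2 ^ s)%N) (qE' : q = (2 * q0 ^ 2)%N).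
Hypothesis hF : suzuki_function_field iota q0 q x y.

Local Notation r := (2 * q0)%N.
(* Names for z and w that rewriting cannot unfold. *)
Variables (z w : F).
Hypotheses (zE : z = suzuki_z q0 x y) (wE' : w = suzuki_w q0 x y).
Local Notation d := (x ^+ q + x).
Local Notation m := (q - r + 1)%N.
Local Notation N := ((q - r + 1) * (q - 1))%N.
Local Notation theta := (suzuki_theta q x).
Local Notation t := (suzuki_t q0 q x).

Let ch : 2%N \in [pchar F]. Proof. exact: (rmorph_pchar iota). Qed.
Let q0r : (q0 * r = q)%N. Proof. by rewrite qE' mulnCA mulnn. Qed.
Let rE : r = (2 ^ s.+1)%N. Proof. by rewrite q0E expnS. Qed.
Let qE : q = (2 ^ (2 * s + 1))%N.
Proof. by rewrite qE' q0E -expnM -expnS mulnC addn1. Qed.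
Let r_gt3 : (3 < r)%N. Proof. exact: suzuki_r_gt3 rE. Qed.
Let r_lt_q : (r.+1 < q)%N. Proof. exact: suzuki_r_lt_q qE rE. Qed.
Let r_gt1 : (1 < r)%N. Proof. exact: ltnW (ltnW r_gt3). Qed.
Let q_gt1 : (1 < q)%N. Proof. exact: ltn_trans r_gt1 (ltnW r_lt_q). Qed.
Let q_gt0 : (0 < q)%N. Proof. exact: ltnW q_gt1. Qed.
Let fq := exprD_q ch qE.
Let fr := exprD_r ch rE.
Let tr_x : ~ algebraicOver iota x. Proof. by case: hF. Qed.

Let addxx (u : F) : u + u = 0. Proof. exact: addrr_pchar2. Qed.

Let xq : x ^+ q = x + d. Proof. by rewrite addrCA addxx addr0. Qed.

(** Raise the curve equation to the power [r], with [q0 * r = q]. *)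
Lemma suzuki_z_equation : z ^+ q + z = x ^+ r * d.
Proof.
case: hF => _ yq _; rewrite zE /suzuki_z fq addrACA.
rewrite [(y ^+ r) ^+ q]exprAC -fr yq (exprMn r (x ^+ q0)) -(exprM x q0) q0r fr.
rewrite [(x ^+ (r + 1)) ^+ q]exprAC addn1 !exprSr.
move: (x ^+ q) (x ^+ r) => a X.
by apply: (eq_pchar2 ch (e := a ^+ r * a)); ring.
Qed.

(** Raising the definition of [z] to the power [q0] produces [y^q], which the curve equation reduces
    to [y]. Hence K(x, y) = K(x, z). *)
Lemma suzuki_yE : y = x ^+ q0.+1 + z ^+ q0.
Proof.
case: hF => _ yq _; rewrite zE /suzuki_z q0E exprD_char2 // -q0E -!exprM.
rewrite mulnDl mul1n mulnC q0r exprD exprSr.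
have -> : y ^+ q = y + x ^+ q0 * d by rewrite -yq addrCA addxx addr0.
move: (x ^+ q) (x ^+ q0) => a b.
by apply: (eq_pchar2 ch (e := - (b * x) - a * b)); ring.
Qed.

Lemma suzuki_wE : w = x * z + x ^+ 2 * x ^+ r + z ^+ r.
Proof.
rewrite wE' /suzuki_w -zE; congr (_ + _); rewrite {1}zE /suzuki_z mulrDr addn1 exprS.
by apply: (eq_pchar2 ch (e := - (x ^+ 2 * x ^+ r))); ring.
Qed.

Let hz := suzuki_z_equation.
Let wE := suzuki_wE.

Let zq : z ^+ q = z + x ^+ r * d. Proof. by rewrite -hz addrCA addxx addr0. Qed.

Lemma suzuki_gen_xz u : generated_subfield iota (fun v => v = x \/ v = z) u.
Proof.
case: hF => _ _ /(_ u); apply: gen_monotone => [c|_ [->|->]].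
- exact: gen_const.
- by apply: gen_elem; left.
have genX v n : generated_subfield iota (fun v => v = x \/ v = z) v ->
    generated_subfield iota (fun v => v = x \/ v = z) (v ^+ n).
  move=> gv; elim: n => [|n IH]; last by rewrite exprS; apply: gen_mul.
  by rewrite expr0 -(rmorph1 iota); apply: gen_const.
by rewrite suzuki_yE; apply: gen_add; apply: genX; apply: gen_elem; [left|right].
Qed.

(** The relation is a polynomial in [z] over K(x) of degree at most [r < q]. *)
Lemma suzuki_independence (a b c : {poly K}) :
    (map_poly iota a).[x] * z ^+ r + (map_poly iota b).[x] * z
      + (map_poly iota c).[x] = 0 ->
  [/\ a = 0, b = 0 & c = 0].
Proof.
move=> abc; have [M [cst [T [emb indep]]]] := rational_function_field K.
have [j [jc jT jgen]] := emb _ _ _ tr_x.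
have hj : z ^+ q + z = j (T ^+ (q + r) + T ^+ r.+1).
  by rewrite hz rmorphD !rmorphXn /= jT exprD exprSr mulrDr mulrC.
pose ev (p : {poly K}) : M := (map_poly cst p).[T].
have evE p : j (ev p) = (map_poly iota p).[x].
  by rewrite -jT -horner_map -map_poly_comp; congr (_.[_]); apply: eq_map_poly.
have ev0 p : ev p = 0 -> p = 0.
  move=> p0; apply/eqP/negPn/negP => pn0; apply: tr_x; exists p => //.
  by rewrite rootE -evE p0 rmorph0.
pose A := (ev a) *: 'X^r + ((ev b) *: 'X + (ev c)%:P).
have A0 : A = 0.
  apply: (indep _ _ _ _ _ _ chK s_gt0 qE rE hj).
    apply: leq_trans (size_polyD _ _) _; rewrite geq_max; apply/andP; split.
      by apply: leq_trans (size_scale_leq _ _) _; rewrite size_polyXn ltnW.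
    apply: leq_trans (size_polyD _ _) _; rewrite geq_max; apply/andP; split.
      apply: leq_trans (size_scale_leq _ _) _; rewrite size_polyX.
      exact: q_gt1.
    exact: leq_trans (size_polyC_leq1 _) q_gt0.
  by rewrite !rmorphD /= !map_polyZ map_polyXn map_polyX map_polyC !hornerE /= !evE.
have rn0 : (r == 0)%N = false by rewrite gtn_eqF // ltnW.
have rn1 : (1 == r)%N = false by rewrite ltn_eqF.
have coefA i : A`_i = ev a * (i == r)%:R + (ev b * (i == 1)%:R + ev c *+ (i == 0%N)).
  by rewrite !coefD !coefZ coefXn coefX coefC; case: (i == 0)%N.
split; apply: ev0.
- have := coefA r; rewrite A0 coef0 eqxx rn0 eq_sym rn1.
  by rewrite mulr1 mulr0 mulr0n !addr0.
- have := coefA 1%N; rewrite A0 coef0 eqxx rn1.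
  by rewrite mulr1 mulr0 mulr0n addr0 add0r.
have := coefA 0%N; rewrite A0 coef0 eqxx eq_sym rn0.
by rewrite !mulr0 mulr1n !add0r.
Qed.

(** F is K(x)[Y] modulo [P0], since [z] has degree [q] over K(x). Evaluating at [x'] and then at
    [z'] kills [P0], hence factors through F. *)
Lemma suzuki_endomorphism (x' z' : F) : ~ algebraicOver iota x' ->
    z' ^+ q + z' = x' ^+ r * (x' ^+ q + x') ->
  exists f : {rmorphism F -> F},
    [/\ forall c, f (iota c) = iota c, f x = x' & f z = z'].
Proof.
move=> tr' hz'; have [M [cst [T [emb indep]]]] := rational_function_field K.
have [j [jc jT jgen]] := emb _ _ _ tr_x.
have [j' [j'c j'T j'gen]] := emb _ _ _ tr'.
pose f0 := T ^+ (q + r) + T ^+ r.+1.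
have f0E (k : {rmorphism M -> F}) v : k T = v -> k f0 = v ^+ r * (v ^+ q + v).
  by move=> kT; rewrite rmorphD !rmorphXn /= kT exprD exprSr mulrDr mulrC.
pose P0 : {poly M} := 'X^q + ('X - f0%:P).
have P0z (k : {rmorphism M -> F}) v v' : k T = v ->
    v' ^+ q + v' = v ^+ r * (v ^+ q + v) -> (map_poly k P0).[v'] = 0.
  move=> kT hv; rewrite rmorphD rmorphB /= map_polyXn map_polyX map_polyC !hornerE /=.
  by rewrite hv (f0E _ _ kT) subrr.
have szP0 : size P0 = q.+1.
  rewrite size_polyDl size_polyXn // (leq_ltn_trans (size_polyD _ _)) //.
  rewrite size_polyX size_polyN gtn_max !ltnS q_gt1.
  exact: leq_trans (size_polyC_leq1 _) q_gt0.
have P00 : P0 != 0 by rewrite -size_poly_gt0 szP0.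
have [|p|f fE] := @rmorphism_factor _ _ _
    (horner_eval z \o map_poly j) (horner_eval z' \o map_poly j').
- move=> u; have gu : generated_subfield j (fun v => v = z) u.
    have := suzuki_gen_xz u; apply: gen_monotone => [c|_ [->|->]].
    + by rewrite -jc; apply: gen_const.
    + by rewrite -jT; apply: gen_const.
    exact: gen_elem.
  have [|P _ ->] := generated_algebraic P00 _ gu; last by exists P.
  by apply/eqP; apply: (P0z _ _ _ jT hz).
- rewrite /= /horner_eval => pz.
  have P0jz := P0z _ _ _ jT hz.
  have : p %% P0 = 0.
    apply: (indep _ _ _ _ _ _ chK s_gt0 qE rE (etrans hz (esym (f0E _ _ jT)))).
      by rewrite -ltnS -szP0 ltn_modp.
    move: pz; rewrite {1}(divp_eq p P0) rmorphD rmorphM hornerD hornerM P0jz.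
    by rewrite mulr0 add0r.
  move=> pP0; rewrite (divp_eq p P0) pP0 addr0 rmorphM hornerM.
  by rewrite (P0z _ _ _ j'T hz') mulr0.
have fj c : f (j c) = j' c.
  by have := fE c%:P; rewrite /= /horner_eval !map_polyC !hornerC.
exists f; split=> [c||].
- by rewrite -jc fj j'c.
- by rewrite -jT fj.
by have := fE 'X; rewrite /= /horner_eval !map_polyX !hornerX.
Qed.

Lemma K_automorphism_inverse (f g : {rmorphism F -> F}) :
    (forall c, f (iota c) = iota c) -> (forall c, g (iota c) = iota c) ->
    g (f x) = x -> g (f z) = z -> f (g x) = x -> f (g z) = z ->
  K_automorphism iota f.
Proof.
move=> fc gc gfx gfz fgx fgz; split=> //; exists g => u.
  apply: (rmorphism_fix_generated (f := g \o f) _ _ (suzuki_gen_xz u)).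
    by move=> c; rewrite /= fc gc.
  by move=> _ [->|->].
apply: (rmorphism_fix_generated (f := f \o g) _ _ (suzuki_gen_xz u)).
  by move=> c; rewrite /= gc fc.
by move=> _ [->|->].
Qed.

Let trans_lin (a b : K) : a != 0 -> ~ algebraicOver iota (iota a * x + iota b).
Proof.
move=> a0; have -> : iota a * x + iota b = (map_poly iota (a *: 'X + b%:P)).[x].
  by rewrite rmorphD /= map_polyZ map_polyX map_polyC !hornerE /=.
apply: transcendental_poly tr_x _; rewrite size_polyDl size_scale ?size_polyX //.
by rewrite (leq_ltn_trans (size_polyC_leq1 _)).
Qed.

Lemma suzuki_tau_exists (a c : K) : a ^+ q = a -> c ^+ q = c ->
  exists f, suzuki_tau iota q0 x y a c f.
Proof.
move=> aq cq.
have tr_xa : ~ algebraicOver iota (x + iota a).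
  by rewrite -[x]mul1r -(rmorph1 iota); apply: trans_lin; rewrite oner_eq0.
have iq (b : K) : b ^+ q = b -> iota b ^+ q = iota b by rewrite -rmorphXn => ->.
have endo c' : c' ^+ q = c' -> exists f : {rmorphism F -> F},
    [/\ forall b, f (iota b) = iota b, f x = x + iota a &
        f z = z + iota (a ^+ r) * x + iota c'].
  move=> c'q; apply: suzuki_endomorphism => //.
  rewrite !fq !fr exprMn !iq //; last by rewrite exprAC aq.
  rewrite xq zq rmorphXn /=; move: (iota a) (iota c') (x ^+ r) d => A C X e.
  by apply: (eq_pchar2 ch (e := z + A ^+ r * x + C - X * x - X * A
    - A ^+ r * x - A ^+ r * A)); ring.
have [f [fc fx fz]] := endo _ cq.
(* The inverse of [tau_{a,c}] is [tau_{a,c'}] with [c' = a^(r+1) + c]. *)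
have [|g [gc gx gz]] := endo (a ^+ r * a + c).
  by rewrite (exprD_q chK qE) exprMn exprAC aq cq.
exists f; rewrite /suzuki_tau -wE' -zE; split=> //.
- apply: (K_automorphism_inverse fc gc).
  + by rewrite fx rmorphD gc gx -addrA addxx addr0.
  + rewrite fz !rmorphD rmorphM !gc gz gx !rmorphD rmorphM /=.
    move: (iota (a ^+ r)) (iota a) (iota c) => B A C.
    by apply: (eq_pchar2 ch (e := B * x + B * A + C)); ring.
  + by rewrite gx rmorphD fc fx -addrA addxx addr0.
  rewrite gz !rmorphD rmorphM !fc fz fx rmorphM /=.
  move: (iota (a ^+ r)) (iota a) (iota c) => B A C.
  by apply: (eq_pchar2 ch (e := B * x + B * A + C)); ring.
rewrite wE !(rmorphD, rmorphM, rmorphXn) /= fx fz.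
rewrite !fr exprMn !rmorphXn /= (expr_rr qE rE) -!rmorphXn aq !rmorphXn /=.
rewrite addn1 addn2 !exprS.
move: (iota a) (iota c) (x ^+ r) (z ^+ r) (iota a ^+ r) (iota c ^+ r) => A C X Z B D.
by apply: (eq_pchar2 ch (e := B * x ^+ 2 + B * A * x + X * A * x + X * A ^+ 2)); ring.
Qed.

Lemma suzuki_psi_exists (e : K) : e ^+ q = e -> e != 0 ->
  exists f, suzuki_psi iota q0 x y e f.
Proof.
move=> eq e0.
have endo e' : e' ^+ q = e' -> e' != 0 -> exists f : {rmorphism F -> F},
    [/\ forall b, f (iota b) = iota b, f x = iota e' * x &
        f z = iota (e' ^+ (r + 1)) * z].
  move=> e'q e'0; have iq : iota e' ^+ q = iota e' by rewrite -rmorphXn e'q.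
  apply: suzuki_endomorphism.
    by rewrite -[_ * x]addr0 -(rmorph0 iota); apply: trans_lin.
  rewrite !exprMn rmorphXn exprAC iq -!mulrDr hz addn1 exprSr.
  by ring.
have [f [fc fx fz]] := endo _ eq e0.
have [||g [gc gx gz]] := endo e^-1; rewrite ?exprVn ?eq ?invr_eq0 //.
exists f; rewrite /suzuki_psi -wE' -zE; split=> //.
  apply: (K_automorphism_inverse fc gc).
  - by rewrite fx rmorphM gc gx mulrA -rmorphM mulfV ?rmorph1 ?mul1r.
  - by rewrite fz rmorphM gc gz mulrA -rmorphM -exprMn mulfV ?expr1n ?rmorph1 ?mul1r.
  - by rewrite gx rmorphM fc fx mulrA -rmorphM mulVf ?rmorph1 ?mul1r.
  by rewrite gz rmorphM fc fz mulrA -rmorphM -exprMn mulVf ?expr1n ?rmorph1 ?mul1r.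
have iq : iota e ^+ q = iota e by rewrite -rmorphXn eq.
rewrite wE !(rmorphD, rmorphM, rmorphXn) /= fx fz !exprMn !rmorphXn /=.
rewrite addn1 addn2 !exprSr exprMn (expr_rr qE rE) iq.
by ring.
Qed.

Lemma suzuki_w_neq0 : w != 0.
Proof.
apply/negP => /eqP w0.
have [|/eqP] := @suzuki_independence 1 'X ('X^2 * 'X^r).
  rewrite rmorph1 map_polyX rmorphM /= !map_polyXn !hornerE -[RHS]w0 wE.
  by ring.
by rewrite oner_eq0.
Qed.

Let w0 := suzuki_w_neq0.

Lemma suzuki_iota_exists : exists f, suzuki_iota iota q0 x y f.
Proof.
have [||f [fc fx fz]] := @suzuki_endomorphism (z / w) (x / w).
- move=> /algebraicOver_closed[k zw].
  have zk : z = iota k * w by rewrite -zw mulfVK.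
  (* If [z / w] were a constant [k], then [z = k w] would be a linear relation in which [z] has the
     coefficient [1 - k x], nonzero for every [k]. *)
  have [|_ /polyP/(_ 0%N) + _] :=
      @suzuki_independence (- k%:P) (1 - k *: 'X) (- (k *: ('X^2 * 'X^r))).
    rewrite rmorphB rmorph1 !rmorphN /= !map_polyZ rmorphM /=.
    rewrite !map_polyXn map_polyX map_polyC !hornerE /=.
    by move/eqP: zk; rewrite -subr_eq0 wE => /eqP <-; ring.
  by rewrite coefB coef1 coefZ coefX mulr0 subr0 coef0 => /eqP; rewrite oner_eq0.
- exact: (involution_equation ch s_gt0 qE rE xq zq wE w0).
have fw : f w = w^-1.
  rewrite {1}wE !(rmorphD, rmorphM, rmorphXn) /= fx fz.
  exact: (w_involution ch qE rE xq zq wE w0).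
have ffx : f (f x) = x by rewrite fx fmorph_div fw fz invrK mulfVK.
have ffz : f (f z) = z by rewrite fz fmorph_div fw fx invrK mulfVK.
exists f; rewrite /suzuki_iota -wE' -zE; split=> //; exact: (K_automorphism_inverse fc fc).
Qed.

Let delta0 : d != 0.
Proof.
apply/eqP => d0; apply: tr_x; exists ('X^q + 'X).
  by rewrite -size_poly_gt0 size_polyDl size_polyXn // size_polyX ltnS.
by apply/eqP; rewrite rmorphD /= map_polyXn map_polyX !hornerE.
Qed.

Let theta0 : theta != 0. Proof. exact: expf_neq0 delta0. Qed.

(** * Invariance of t under the generators *)

Local Notation D3 := (w ^+ (q ^ 3) + w + x * z ^+ (q ^ 3) + z * x ^+ (q ^ 3)).

(** With [D3 = B(theta) d^(q+r+1)], this follows from [(q + r + 1) m = q^2 + 1] and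
    [q^3 + 1 = (q^2 + 1) + (q - 1) q^2]. *)
Lemma suzuki_tE : t = D3 ^+ m / d ^+ (q ^ 3 + 1).
Proof.
have d0 n : d ^+ n != 0 by rewrite expf_neq0 ?delta0.
have q1E : (q = (q - 1).+1)%N by rewrite subn1 prednK.
have -> : D3 = suzuki_B q0 q theta * d ^+ (q + r + 1).
  rewrite (frobenius_form ch s_gt0 qE rE xq zq wE w0) /suzuki_B /suzuki_theta.
  rewrite !mulrDl mul1r -!exprM -!exprD.
  case: (q) q1E => // q1 _; rewrite subn1 /=; move: (2 * q0)%N => r'.
  by congr (_ + _ ^+ _ + _ ^+ _ + _ ^+ _); nia.
have mE := suzuki_norm s_gt0 qE rE.
have NE : d ^+ (q ^ 3 + 1) = d ^+ (q ^ 2 + 1) * d ^+ ((q - 1) * q ^ 2).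
  rewrite -exprD; congr (_ ^+ _).
  by case: (q) q_gt0 => // q1 _; rewrite subn1 /=; nia.
have dE : (d ^+ (q + r + 1)) ^+ m = d ^+ (q ^ 2 + 1) by rewrite -exprM mE.
have thE : theta ^+ (q ^ 2) = d ^+ ((q - 1) * q ^ 2) by rewrite -exprM.
rewrite /suzuki_t exprMn dE thE NE.
move: (d0 (q ^ 2 + 1)%N) (d0 ((q - 1) * q ^ 2)%N).
move: (d ^+ (q ^ 2 + 1)) (d ^+ ((q - 1) * q ^ 2)) (_ ^+ m) => a b c a0 b0.
by field; rewrite a0 b0.
Qed.

(* The image of w under tau_{a,c}. *)
Let ell (a c : K) : F := w + iota a * z + iota (a ^+ (r + 1) + c) * x
  + iota (a ^+ (r + 2) + a * c + c ^+ r).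

(** The three equations are the coefficients of [z^r], of [z] and of [x] in the relation. They serve
    to show that the [ell a c] are nonzero, nonconstant and pairwise non-proportional. *)
Let ell_lin k k' k0 a c a' c' :
    iota k * ell a c + iota k' * ell a' c' + iota k0 = 0 ->
  [/\ k + k' = 0, k * a + k' * a' = 0 &
      k * (a ^+ (r + 1) + c) + k' * (a' ^+ (r + 1) + c') = 0].
Proof.
move=> lin.
pose b0 a c : K := a ^+ (r + 2) + a * c + c ^+ r.
pose A : {poly K} := (k + k')%:P.
pose B : {poly K} := (k + k') *: 'X + (k * a + k' * a')%:P.
pose C : {poly K} := (k + k') *: ('X^2 * 'X^r) +
  (k * (a ^+ (r + 1) + c) + k' * (a' ^+ (r + 1) + c')) *: 'X +
  (k * b0 a c + k' * b0 a' c' + k0)%:P.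
have [|/polyP/(_ 0%N) A0 /polyP/(_ 0%N) B0 /polyP/(_ 1%N) C1] :=
    @suzuki_independence A B C.
  rewrite -[RHS]lin /ell /A /B /C !wE !(rmorphD, rmorphM) /= !map_polyZ !map_polyC.
  rewrite rmorphM /= !map_polyXn map_polyX !hornerE /= !(rmorphD, rmorphM) /=.
  by ring.
split.
- by move: A0; rewrite coefC coef0.
- by move: B0; rewrite coefD coefZ coefX coefC mulr0 add0r coef0.
move: C1; rewrite !coefD !coefZ -exprD coefXn coefX coefC mulr1 addr0 coef0.
by rewrite mulr0 add0r.
Qed.

Let Fq_units (e : K) : e ^+ q = e -> e != 0 -> e ^+ (q - 1) = 1.
Proof.
by move=> eq e0; apply: (mulfI e0); rewrite -exprS subn1 prednK // eq mulr1.
Qed.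

Lemma suzuki_t_fixed f : suzuki_generator iota q0 q x y f -> f t = t.
Proof.
have ft (g : {rmorphism F -> F}) : g t = suzuki_t q0 q (g x).
  rewrite /suzuki_t /suzuki_B /suzuki_theta fmorph_div !rmorphXn !rmorphD rmorph1.
  by rewrite !rmorphXn rmorphD rmorphXn.
(* Here [t] depends on [x] only through [theta]. The [tau] fix [d], and [psi] multiplies it by some
   [e] with [e^(q-1) = 1], so both fix [theta]. *)
have tE x' : suzuki_theta q x' = theta -> suzuki_t q0 q x' = t.
  by rewrite /suzuki_t => ->.
case=> [[a [c [aq cq [_ fx _ _]]]]|[e [eq e0 [_ fx _ _]]]|].
- rewrite ft; apply: tE; rewrite fx /suzuki_theta fq -rmorphXn /= aq.
  by rewrite addrACA addxx addr0.
- rewrite ft; apply: tE; rewrite fx /suzuki_theta exprMn -rmorphXn /= eq -mulrDr.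
  by rewrite exprMn -rmorphXn Fq_units // rmorph1 mul1r.
rewrite /suzuki_iota -wE' -zE => -[_ fx fz fw].
have fd : f d = d / w ^+ m.
  by rewrite rmorphD rmorphXn /= fx (delta_involution ch s_gt0 qE rE xq zq wE w0).
have wn0 n : w ^+ n != 0 by rewrite expf_neq0.
(* The involution sends (1, x, z, w) to (w, z, x, 1) divided by [w], and [D3] is symmetric under
   this reversal. *)
have fD3 : f D3 = D3 / w ^+ (q ^ 3 + 1).
  rewrite !(rmorphD, rmorphM, rmorphXn) /= fx fz fw addn1 exprSr !expr_div_n exprVn.
  move: (w ^+ _) (wn0 (q ^ 3)%N) (x ^+ _) (z ^+ _) => a a0 b c.
  by field; rewrite w0 a0.
rewrite suzuki_tE fmorph_div (rmorphXn f m) (rmorphXn f (q ^ 3 + 1)%N) /= fD3 fd.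
rewrite !(expr_div_n _ (w ^+ _)) -!exprM [(m * _)%N]mulnC.
have dn0 : d ^+ (q ^ 3 + 1) != 0 by rewrite expf_neq0.
move: dn0 (wn0 ((q ^ 3 + 1) * m)%N).
move: (d ^+ (q ^ 3 + 1)) (w ^+ _) (D3 ^+ m) => a b c a0 b0.
by field; rewrite a0 b0.
Qed.

(** * Descent of the fixed elements to K(t) *)

Let involution_theta f : suzuki_iota iota q0 x y f -> f theta = theta / w ^+ N.
Proof.
rewrite /suzuki_iota -wE' -zE => -[_ fx _ _].
rewrite rmorphXn rmorphD rmorphXn /= fx (delta_involution ch s_gt0 qE rE xq zq wE w0).
by rewrite expr_div_n -exprM.
Qed.

Lemma suzuki_fixed u :
    (forall f, suzuki_generator iota q0 q x y f -> f u = u) ->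
  generated_subfield iota (fun v => v = t) u.
Proof.
move=> fixu.
have tau a c : a ^+ q = a -> c ^+ q = c -> exists f : {rmorphism F -> F},
    [/\ [/\ forall b, f (iota b) = iota b, f u = u & f t = t], f x = x + iota a,
      f z = z + iota (a ^+ r) * x + iota c & f w = ell a c].
  move=> aq cq; have [f hf] := suzuki_tau_exists aq cq; exists f.
  have fu : f u = u by apply: fixu; apply: Or31; exists a, c.
  have ft : f t = t by apply: suzuki_t_fixed; apply: Or31; exists a, c.
  by case: hf => -[_ fc] fx; rewrite -zE -wE'.
have e0 : (0 < 2 * s + 1)%N by rewrite addn1.
have [rs [urs szrs rsP]] := fixed_Frobenius chK e0; rewrite -qE in szrs rsP.
have zq0 : (0 : K) ^+ q = 0 by rewrite expr0n gtn_eqF.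
(* The conjugates of [z] over K(x) are the [z + c], reached by [tau_{0,c}]. *)
have ux : generated_subfield iota (fun v => v = x) u.
  have [M [cst [T [emb indep]]]] := rational_function_field K.
  have [j [jc jT jgen]] := emb _ _ _ tr_x.
  have [c ->] : exists c, u = j c; last exact: jgen.
  pose f0 := T ^+ (q + r) + T ^+ r.+1.
  have f0E : j f0 = x ^+ r * (x ^+ q + x).
    by rewrite rmorphD !rmorphXn /= jT exprD exprSr mulrDr mulrC.
  pose P0 : {poly M} := 'X^q + ('X - f0%:P).
  have szP0 : size P0 = q.+1.
    rewrite size_polyDl size_polyXn // (leq_ltn_trans (size_polyD _ _)) //.
    rewrite size_polyX size_polyN gtn_max !ltnS q_gt1.
    exact: leq_trans (size_polyC_leq1 _) q_gt0.
  apply: (@fixed_descent _ _ j z u P0 [seq z + iota c | c <- rs]).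
  - by rewrite -size_poly_gt0 szP0.
  - rewrite rootE rmorphD rmorphB /= map_polyXn map_polyX map_polyC !hornerE /=.
    by rewrite hz f0E subrr.
  - by rewrite map_inj_uniq // => b c /addrI/fmorph_inj.
  - by rewrite size_map szrs szP0.
  - move=> _ /mapP[c /[!rsP]/eqP cq ->]; have [f [[fc fu _] fx fz _]] := tau _ _ zq0 cq.
    exists f; split=> [b||]; rewrite ?fu //.
      apply: (rmorphism_fix_generated fc _ (jgen b)) => _ ->.
      by rewrite fx rmorph0 addr0.
    by rewrite fz expr0n gtn_eqF ?(ltnW r_gt1) // rmorph0 mul0r addr0.
  have := suzuki_gen_xz u; apply: gen_monotone => [c|_ [->|->]].
  + by rewrite -jc; apply: gen_const.
  + by rewrite -jT; apply: gen_const.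
  exact: gen_elem.
have szXqX : size ('X^q + 'X : {poly K}) = q.+1.
  by rewrite size_polyDl size_polyXn // size_polyX ltnS.
have dE : d = (map_poly iota ('X^q + 'X)).[x].
  by rewrite rmorphD /= map_polyXn map_polyX !hornerE.
have tr_d : ~ algebraicOver iota d.
  by rewrite dE; apply: transcendental_poly; rewrite ?szXqX.
(* The conjugates of [x] over K(d) are the [x + c], reached by [tau_{c,0}]. *)
have ud : generated_subfield iota (fun v => v = d) u.
  apply: (descent_step (A := 'X^q + 'X) (B := 1)
    (rs := [seq x + iota c | c <- rs]) tr_d _ _ _ _ _ ux).
  - by rewrite szXqX size_poly1 ltnS.
  - by rewrite rmorph1 hornerE mulr1 dE.
  - by rewrite map_inj_uniq // => b c /addrI/fmorph_inj.
  - by rewrite size_map szrs szXqX.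
  move=> _ /mapP[c /[!rsP]/eqP cq ->]; have [f [[fc fu _] fx fz _]] := tau _ _ cq zq0.
  exists f; split=> //; rewrite rmorphD rmorphXn /= fx fq -rmorphXn /= cq.
  by rewrite addrACA addxx addr0.
have thE : theta = (map_poly iota ('X^(q - 1))).[d].
  by rewrite map_polyXn hornerXn.
have q1_gt0 : (0 < q - 1)%N by rewrite subn_gt0.
have tr_th : ~ algebraicOver iota theta.
  by rewrite thE; apply: transcendental_poly; rewrite ?size_polyXn.
(* The conjugates of [d] over K(theta) are its multiples by F_q^*, listed by [rem 0 rs] and reached
   by [psi]. *)
have uth : generated_subfield iota (fun v => v = theta) u.
  apply: (descent_step (A := 'X^(q - 1)) (B := 1)
    (rs := [seq iota c * d | c <- rem 0 rs]) tr_th _ _ _ _ _ ud).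
  - by rewrite size_polyXn size_poly1.
  - by rewrite rmorph1 hornerE mulr1 thE.
  - by rewrite map_inj_uniq ?rem_uniq // => b c /(mulIf delta0)/fmorph_inj.
  - by rewrite size_map size_polyXn size_rem ?rsP ?zq0 // szrs subn1.
  move=> _ /mapP[e /[!mem_rem_uniq] // /andP[/= e_neq0 /[!rsP]/eqP eq] ->].
  have [f hf] := suzuki_psi_exists eq e_neq0.
  have fu : f u = u by apply: fixu; apply: Or32; exists e.
  case: hf => -[_ fc] fx _ _.
  have fd : f d = iota e * d by rewrite rmorphD rmorphXn /= fx exprMn -rmorphXn eq mulrDr.
  exists f; split=> //; rewrite /suzuki_theta rmorphXn /= fd exprMn -rmorphXn.
  by rewrite Fq_units // rmorph1 mul1r.
(* This is [B_S] with its leading term first. Its m-th power has degree [q^2 + 1], one more than the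
   denominator of [t]. *)
pose Bp : {poly K} := 'X^(q + r + 1) + (1 + 'X^q + 'X^(q + r)).
have szBp : size Bp = (q + r + 1).+1.
  have qr : (q < q + r + 1)%N by rewrite -addnA -addn1 leq_add2l addn1.
  rewrite size_polyDl size_polyXn // (leq_ltn_trans (size_polyD _ _)) //.
  rewrite gtn_max size_polyXn addn1 leqnn andbT (leq_ltn_trans (size_polyD _ _)) //.
  by rewrite gtn_max size_poly1 size_polyXn; move: q_gt0 r_gt1; lia.
have mE := suzuki_norm s_gt0 qE rE.
have szA : size (Bp ^+ m) = (q ^ 2 + 2)%N.
  have B0 : Bp ^+ m != 0 by rewrite expf_neq0 // -size_poly_gt0 szBp.
  have := size_exp Bp m; rewrite szBp mE => e.
  by rewrite -(prednK (_ : 0 < size (Bp ^+ m)))%N ?size_poly_gt0 // e !addnS.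
have AB : (map_poly iota (Bp ^+ m)).[theta] = t * (map_poly iota 'X^(q ^ 2)).[theta].
  rewrite map_polyXn hornerXn divfK ?expf_neq0 // rmorphXn horner_exp; congr (_ ^+ _).
  rewrite /Bp /suzuki_B !rmorphD rmorph1 /= !map_polyXn.
  by rewrite !hornerD !hornerXn -polyC1 hornerC addrC.
have tr_t : ~ algebraicOver iota t.
  move=> /algebraicOver_closed[c tc]; apply: tr_th.
  exists (Bp ^+ m - c *: 'X^(q ^ 2)).
    rewrite -size_poly_gt0 size_polyDl szA ?addn2 // size_polyN.
    by rewrite (leq_ltn_trans (size_scale_leq _ _)) // size_polyXn.
  by rewrite rootE rmorphB /= map_polyZ hornerD hornerN hornerZ -tc AB subrr.
have ell0 a c : ell a c != 0.
  apply/eqP => l0; have [|/eqP] := @ell_lin 1 0 0 a c 0 0.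
    by rewrite l0 mulr0 rmorph0 mul0r !addr0.
  by rewrite addr0 oner_eq0.
have N0 : (0 < N)%N by rewrite muln_gt0 q1_gt0 addn1.
(* The ratio is an N-th root of unity, hence a constant. *)
have ell_root a c v : ell a c ^+ N = v ^+ N -> v != 0 ->
    exists k', ell a c = iota k' * v.
  move=> lv v0; have [k' lk] : exists k', ell a c / v = iota k'.
    apply/algebraicOver_closed; exists ('X^N - 1).
      by rewrite -size_poly_gt0 size_polyDl size_polyXn // size_polyN size_poly1.
    rewrite rootE rmorphB rmorph1 /= map_polyXn !hornerE expr_div_n lv.
    by rewrite divff ?subrr ?expf_neq0.
  by exists k'; rewrite -lk divfK.
apply: (descent_step (A := Bp ^+ m) (B := 'X^(q ^ 2))
  (rs := theta :: [seq theta / ell a c ^+ N | a <- rs, c <- rs]) tr_t _ AB _ _ _ uth).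
- by rewrite szA size_polyXn addn2.
- have th_inj v v' : theta / v ^+ N = theta / v' ^+ N -> v ^+ N = v' ^+ N.
    by move/(mulfI theta0)/invr_inj.
  rewrite cons_uniq; apply/andP; split.
    apply/negP => /allpairsP[[a c] /= [_ _]].
    rewrite -{1}[theta]divr1 -(expr1n _ N) => /th_inj/esym le.
    have [k lk] := ell_root a c 1 le (oner_neq0 _).
    have [|/eqP] := @ell_lin 1 0 (- k) a c 0 0.
      by rewrite lk rmorphN rmorph0 rmorph1 mul0r addr0 mul1r mulr1 subrr.
    by rewrite addr0 oner_eq0.
  (* If two images agree, the two forms are proportional. The coefficient of [z^r] makes the factor
     1, that of [z] gives [a = a'], and that of [x] gives [c = c']. *)
  apply: allpairs_uniq => // -[a c] [a' c'] _ _ /= /th_inj le.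
  have [k lk] := ell_root a c _ le (ell0 a' c').
  have [|] := @ell_lin 1 (- k) 0 a c a' c'.
    by rewrite lk rmorphN rmorph0 rmorph1 mulNr addr0 mul1r subrr.
  move/eqP; rewrite subr_eq0 => /eqP <-; rewrite !mulN1r !mul1r.
  move/eqP; rewrite subr_eq0 => /eqP -> /eqP.
  by rewrite subr_eq0 => /eqP/addrI ->.
- by rewrite /= size_allpairs szrs szA -mulnn addn2.
move=> v; rewrite inE => /predU1P[->|/allpairsP[[a c] /= [/[!rsP]/eqP aq /eqP cq ->]]].
  by exists idfun; split.
have [f [[fc fu ft] fx fz fw]] := tau _ _ aq cq.
have [g hg] := suzuki_iota_exists.
have gth := involution_theta hg.
have gu : g u = u by apply: fixu; apply: Or33.
have gt : g t = t by apply: suzuki_t_fixed; apply: Or33.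
have fth : f theta = theta.
  rewrite rmorphXn rmorphD rmorphXn /= fx fq -rmorphXn /= aq.
  by rewrite addrACA addxx addr0.
have gc : forall b, g (iota b) = iota b by case: hg => -[].
(* The involution [g] sends [theta] to [theta / w^N]; then [f = tau_{a,c}] fixes [theta] and
   replaces [w] by [ell a c]. *)
exists (f \o g); split => [b|||] /=.
- by rewrite gc fc.
- by rewrite gt ft.
- by rewrite gu fu.
by rewrite gth fmorph_div rmorphXn /= fth fw.
Qed.
End SuzukiField.

Theorem theorem3p5 (s q0 q : nat) (hs : (1 <= s)%N)
    (hq0 : q0 = (2 ^ s)%N) (hq : q = (2 * q0 ^ 2)%N)
    (K : closedFieldType) (hchar : 2%N \in [pchar K])
    (F : fieldType) (iota : {rmorphism K -> F}) (x y : F)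
    (hF : suzuki_function_field iota q0 q x y) :
  forall u : F,
    fixed_field (Sz iota q0 q x y) u <->
    generated_subfield iota (fun v => v = suzuki_t q0 q x) u.
Proof.
move=> u; split=> [fixu|gu f Szf].
  apply: (suzuki_fixed hchar hs hq0 hq hF erefl erefl) => f hf.
  by apply/fixu/grp_gen.
(* Fixing K and fixing [t] both pass from the generators to the whole group, by induction on its
   generation. *)
suff [fc ft] : (forall c, f (iota c) = iota c) /\
    f (suzuki_t q0 q x) = suzuki_t q0 q x.
  by apply: (rmorphism_fix_generated fc _ gu) => _ ->.
elim: Szf => {f} [f hf|f f1|f g h _ [fc ft] _ [gc gt] hE|f g _ [fc ft] fK gK].
- split; last exact: (suzuki_t_fixed hchar hs hq0 hq hF erefl erefl hf).
  by case: hf => [[a [c [_ _ []]]]|[e [_ _ []]]|[]] [].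
- by split=> [c|]; rewrite f1.
- by split=> [c|]; rewrite hE /= ?gc ?gt.
by split=> [c|]; [rewrite -{1}[iota c]fc fK | rewrite -{1}ft fK].
Qed.
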